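(* Let $n\ge 1$, $A\in\mathbb{R}^{n\times n}$ nonsingular, $b\in\mathbb{R}^n$ and $\gamma>0$, and consider the dynamical system $$\frac{dx}{dt}=\gamma A^\top\left(b+|x|-Ax\right).$$ If $\|A^{-1}\|\le 1$, then the equilibrium point $x^*$ (if it exists) of this dynamical system is asymptotically stable. In particular, if $\|A^{-1}\|<1$, then the unique equilibrium point $x^*$ of this dynamical system is globally asymptotically stable.
   Context: For a matrix, $\|\cdot\|$ is the spectral norm; for a vector, it is the Euclidean norm. The second-order cone is $\mathcal{K}^n=\{(x_1,x_2)\in\mathbb{R}\times\mathbb{R}^{n-1}:\|x_2\|\le x_1\}$; for $n=1$, $\mathcal{K}^1=\mathbb{R}_+$. The vector $|x|$ is not the componentwise absolute value. It is $|x|=\sqrt{x\circ x}$ with respect to the Jordan product $x\circ y=(\langle x,y\rangle,\,y_1x_2+x_1y_2)$, where the square root is the one in $\mathcal{K}^n$ defined through the spectral decomposition. Explicitly, for $x=(x_1,x_2)\in\mathbb{R}\times\mathbb{R}^{n-1}$: $$|x|=\tfrac12\Big(\big|x_1-\|x_2\|\big|+\big|x_1+\|x_2\|\big|,\ \big(\big|x_1+\|x_2\|\big|-\big|x_1-\|x_2\|\big|\big)\tfrac{x_2}{\|x_2\|}\Big)\ \text{ if } x_2\ne 0,$$ and $|x|=(|x_1|,0)$ if $x_2=0$ (for $n=1$ this is the usual absolute value). For an autonomous system $\frac{dx}{dt}=g(x)$, write $x(t;x(t_0))$ for the solution with initial value $x(t_0)=x_0$. An equilibrium point is a point $x^*$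 with $g(x^* )=0$. It is stable if for every $\epsilon>0$ there is $\delta=\delta(\epsilon)>0$ such that $\|x(t_0)-x^*\|<\delta$ implies $\|x(t;x(t_0))-x^*\|<\epsilon$ for all $t\ge t_0$. It is asymptotically stable if it is stable and $\delta$ can be chosen such that $\|x(t_0)-x^*\|<\delta$ implies $\lim_{t\to\infty}x(t;x(t_0))=x^*$. It is globally asymptotically stable if it is stable and $\lim_{t\to\infty}x(t;x(t_0))=x^*$ for every initial value $x(t_0)\in\mathbb{R}^n$.
   Formalization: In the first claim (‖A⁻¹‖ ≤ 1) the equilibrium x* is assumed to be the only one; otherwise the claim fails: for n=1, A=1, b=0 every x ≥ 0 is an equilibrium and x*=1 is not asymptotically stable. *)

(* Defs.v *)
From mathcomp Require Import all_boot all_order all_algebra.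
From mathcomp Require Import all_classical all_reals all_analysis.

Set Implicit Arguments.
Unset Strict Implicit.
Unset Printing Implicit Defensive.

Import Order.TTheory GRing.Theory Num.Theory.
Import numFieldNormedType.Exports.

Local Open Scope classical_set_scope.
Local Open Scope ring_scope.

(* The library norm [`|x|] on matrices is the max norm, whose topology is the
   usual one; the Euclidean and spectral norms are therefore defined here. *)
Definition enorm (R : realType) (n : nat) (x : 'cV[R]_n) : R :=
  Num.sqrt (\sum_(i < n) x i 0 ^+ 2).

Definition spectral_norm (R : realType) (m n : nat) (A : 'M[R]_(m, n)) : R :=
  sup [set enorm (A *m u) | u in [set u : 'cV[R]_n | enorm u <= 1]].

(* Vectors of R^n with n = m.+1 are split as (x1, x2) in R x R^m. *)
Definition soc_head (R : realType) (m : nat) (x : 'cV[R]_m.+1) : R := x 0 0.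

Definition soc_tail (R : realType) (m : nat) (x : 'cV[R]_m.+1) : 'cV[R]_m :=
  dsubmx (x : 'cV[R]_(1 + m)).

Definition soc_vec (R : realType) (m : nat) (a : R) (v : 'cV[R]_m) :
    'cV[R]_m.+1 :=
  col_mx (const_mx a : 'cV[R]_1) v.

(* |x| = sqrt (x o x) for the Jordan product
   x o y = (<x, y>, y1 x2 + x1 y2) of the second-order cone, written out by the
   spectral decomposition of x, whose eigenvalues are x1 -+ ||x2||. *)
Definition soc_abs (R : realType) (m : nat) (x : 'cV[R]_m.+1) : 'cV[R]_m.+1 :=
  let x1 := soc_head x in
  let x2 := soc_tail x in
  let r := enorm x2 in
  if x2 == 0 then soc_vec `|x1| 0
  else 2^-1 *: soc_vec (`|x1 - r| + `|x1 + r|)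
                       ((`|x1 + r| - `|x1 - r|) *: (r^-1 *: x2)).

(* Classical solution of dx/dt = g x on [t0, +oo[ with x t0 = x0. By
   continuity of x at t0 (and of g), the equation then also holds at t0 with the
   right derivative. The values of x before t0 are irrelevant. *)
Definition is_solution (R : realType) (n : nat) (g : 'cV[R]_n -> 'cV[R]_n)
    (t0 : R) (x0 : 'cV[R]_n) (x : R -> 'cV[R]_n) : Prop :=
  [/\ x t0 = x0,
      {within `[t0, +oo[, continuous x} &
      forall t : R, t0 < t -> is_derive t 1 x (g (x t))].

Definition equilibrium (R : realType) (n : nat) (g : 'cV[R]_n -> 'cV[R]_n)
    (xs : 'cV[R]_n) : Prop :=
  g xs = 0.

Definition stable (R : realType) (n : nat) (g : 'cV[R]_n -> 'cV[R]_n)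
    (xs : 'cV[R]_n) : Prop :=
  forall eps : R, 0 < eps -> exists2 delta : R, 0 < delta &
    forall (t0 : R) (x0 : 'cV[R]_n) (x : R -> 'cV[R]_n),
      is_solution g t0 x0 x -> enorm (x0 - xs) < delta ->
      forall t : R, t0 <= t -> enorm (x t - xs) < eps.

Definition asymptotically_stable (R : realType) (n : nat)
    (g : 'cV[R]_n -> 'cV[R]_n) (xs : 'cV[R]_n) : Prop :=
  stable g xs /\
  exists2 delta : R, 0 < delta &
    forall (t0 : R) (x0 : 'cV[R]_n) (x : R -> 'cV[R]_n),
      is_solution g t0 x0 x -> enorm (x0 - xs) < delta ->
      x t @[t --> +oo] --> xs.

Definition globally_asymptotically_stable (R : realType) (n : nat)
    (g : 'cV[R]_n -> 'cV[R]_n) (xs : 'cV[R]_n) : Prop :=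
  stable g xs /\
  forall (t0 : R) (x0 : 'cV[R]_n) (x : R -> 'cV[R]_n),
    is_solution g t0 x0 x -> x t @[t --> +oo] --> xs.

Definition soc_ave_field (R : realType) (m : nat) (gamma : R)
    (A : 'M[R]_m.+1) (b x : 'cV[R]_m.+1) : 'cV[R]_m.+1 :=
  gamma *: (A^T *m (b + soc_abs x - A *m x)).

(* Main.v *)
Require Import Defs.
From mathcomp Require Import all_boot all_order all_algebra.
From mathcomp Require Import all_classical all_reals all_analysis.
From mathcomp Require Import ring lra.
Set Implicit Arguments.
Unset Strict Implicit.
Unset Printing Implicit Defensive.
Import Order.TTheory GRing.Theory Num.Theory.
Import numFieldNormedType.Exports.
Local Open Scope classical_set_scope.
Local Open Scope ring_scope.

(* The function [V x = ||x - x*||^2] is a strict Lyapunov function. Put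
   [f x = b + |x| - A x], so that [f x* = 0], [u = x - x*] and
   [w = |x| - |x*|]. Since the cone is self-dual, [|.|] is nonexpansive; hence
   [||w|| <= ||u|| <= ||A u||] when [||A^-1|| <= 1], and
   [<u, A^T f x> = <A u, w - A u> <= - ||w - A u||^2 / 2 = - ||f x||^2 / 2].
   A trajectory staying away from [x*] would remain in a compact annulus on
   which [||f||] is bounded below, forcing [V] to become negative. The residual
   vanishes only at a unique equilibrium, so convergence is global even under
   [||A^-1|| <= 1]. When [||A^-1|| < 1], an equilibrium is a fixed point of the
   contraction [T x = A^-1 (b + |x|)], found by minimizing [||x - T x||] on an
   invariant ball. *)

(** * Euclidean inner product, norm and compactness for column vectors *)

Definition dot {R : realType} {n : nat} (x y : 'cV[R]_n) : R :=
  \sum_(i < n) x i 0 * y i 0.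

Section Euclidean.
Context {R : realType}.
Implicit Types (n m : nat) (a : R).

Lemma dotC n (x y : 'cV[R]_n) : dot x y = dot y x.
Proof. by apply: eq_bigr => i _; rewrite mulrC. Qed.

Lemma dotDl n (x y z : 'cV[R]_n) : dot (x + y) z = dot x z + dot y z.
Proof. by rewrite -big_split; apply: eq_bigr => i _ /=; rewrite mxE mulrDl. Qed.

Lemma dotZl n a (x y : 'cV[R]_n) : dot (a *: x) y = a * dot x y.
Proof. by rewrite mulr_sumr; apply: eq_bigr => i _; rewrite mxE mulrA. Qed.

Lemma dotNl n (x y : 'cV[R]_n) : dot (- x) y = - dot x y.
Proof. by rewrite -scaleN1r dotZl mulN1r. Qed.

Lemma dotDr n (x y z : 'cV[R]_n) : dot z (x + y) = dot z x + dot z y.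
Proof. by rewrite dotC dotDl !(dotC z). Qed.

Lemma dotZr n a (x y : 'cV[R]_n) : dot x (a *: y) = a * dot x y.
Proof. by rewrite dotC dotZl dotC. Qed.

Lemma dotNr n (x y : 'cV[R]_n) : dot x (- y) = - dot x y.
Proof. by rewrite dotC dotNl dotC. Qed.

Definition dotE := (dotDl, dotDr, dotNl, dotNr, dotZl, dotZr).

Lemma dot_trmxr m n (A : 'M[R]_(m, n)) (x : 'cV[R]_n) (y : 'cV[R]_m) :
  dot x (A^T *m y) = dot (A *m x) y.
Proof.
rewrite /dot; under eq_bigr do rewrite mxE mulr_sumr.
rewrite exchange_big; apply: eq_bigr => i _ /=; rewrite mxE mulr_suml.
by apply: eq_bigr => j _; rewrite mxE; ring.
Qed.

Lemma dot_ge0 n (x : 'cV[R]_n) : 0 <= dot x x.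
Proof. by apply: sumr_ge0 => i _; rewrite -expr2 sqr_ge0. Qed.

Lemma dot_eq0 n (x : 'cV[R]_n) : (dot x x == 0) = (x == 0).
Proof.
apply/idP/eqP => [|->]; last by apply/eqP/big1 => i _; rewrite mxE mul0r.
rewrite psumr_eq0 => [/allP x0|i _]; last by rewrite -expr2 sqr_ge0.
apply/colP => i; rewrite mxE; apply/eqP.
by have := x0 i (mem_index_enum i); rewrite mulf_eq0 orbb.
Qed.

Lemma enorm_dot n (x : 'cV[R]_n) : enorm x = Num.sqrt (dot x x).
Proof. by []. Qed.

Lemma enorm_ge0 n (x : 'cV[R]_n) : 0 <= enorm x.
Proof. exact: sqrtr_ge0. Qed.

Lemma sqr_enorm n (x : 'cV[R]_n) : enorm x ^+ 2 = dot x x.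
Proof. by rewrite enorm_dot sqr_sqrtr// dot_ge0. Qed.

Lemma enorm_eq0 n (x : 'cV[R]_n) : (enorm x == 0) = (x == 0).
Proof. by rewrite -sqrf_eq0 sqr_enorm dot_eq0. Qed.

Lemma enorm0 n : enorm (0 : 'cV[R]_n) = 0.
Proof. by apply/eqP; rewrite enorm_eq0. Qed.

Lemma enormZ n a (x : 'cV[R]_n) : enorm (a *: x) = `|a| * enorm x.
Proof.
by rewrite !enorm_dot !dotE mulrA -expr2 sqrtrM ?sqr_ge0// sqrtr_sqr.
Qed.

Lemma enormN n (x : 'cV[R]_n) : enorm (- x) = enorm x.
Proof. by rewrite -scaleN1r enormZ normrN1 mul1r. Qed.

Lemma enorm_distC n (x y : 'cV[R]_n) : enorm (x - y) = enorm (y - x).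
Proof. by rewrite -enormN opprB. Qed.

(** Cauchy-Schwarz: with [a = ||x||], [b = ||y||], [c = <x, y>], expanding [||b x - a y||^2 >= 0]
    gives [2 a b (a b - c) >= 0], and [a b > 0] once zero vectors are set aside. *)
Lemma dot_le n (x y : 'cV[R]_n) : dot x y <= enorm x * enorm y.
Proof.
have [x0|x0] := eqVneq x 0.
  by rewrite x0 enorm0 mul0r -(scale0r 0) dotZl mul0r.
have [y0|y0] := eqVneq y 0.
  by rewrite y0 enorm0 mulr0 -(scale0r 0) dotZr mul0r.
have := dot_ge0 (enorm y *: x - enorm x *: y).
rewrite !dotE -!sqr_enorm (dotC y).
have : 0 < enorm x * enorm y.
  by rewrite mulr_gt0// lt_neqAle enorm_ge0 eq_sym enorm_eq0 ?x0 ?y0.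
set a := enorm x; set b := enorm y; set c := dot x y => ab h.
have : 0 <= (a * b) * (a * b - c) by nra.
by rewrite pmulr_rge0// subr_ge0.
Qed.

Lemma normr_dot_le n (x y : 'cV[R]_n) : `|dot x y| <= enorm x * enorm y.
Proof.
by rewrite ler_norml dot_le andbT lerNl -dotNl (le_trans (dot_le _ _))// enormN.
Qed.

Lemma ler_enormD n (x y : 'cV[R]_n) : enorm (x + y) <= enorm x + enorm y.
Proof.
rewrite -(ler_pXn2r (_ : 0 < 2)%N) ?nnegrE ?addr_ge0 ?enorm_ge0//.
have := dot_le x y; have := sqr_enorm x; have := sqr_enorm y.
rewrite (sqr_enorm (x + y)) !dotE (dotC y x); nra.
Qed.

Lemma ler_dist_enorm n (x y : 'cV[R]_n) :
  `|enorm x - enorm y| <= enorm (x - y).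
Proof.
have := ler_enormD (x - y) y; have := ler_enormD (y - x) x.
by rewrite !subrK (enorm_distC y) ler_norml; lra.
Qed.

Lemma normr_coord_le_enorm n (x : 'cV[R]_n) i : `|x i 0| <= enorm x.
Proof.
rewrite enorm_dot -sqrtr_sqr ler_sqrt ?dot_ge0// /dot (bigD1 i)//= -expr2 lerDl.
by apply: sumr_ge0 => j _; rewrite -expr2 sqr_ge0.
Qed.

Lemma normr_le_enorm n (x : 'cV[R]_n) : `|x| <= enorm x.
Proof.
rewrite [leLHS]/Num.Def.normr/= mx_normrE (bigmax_le _ (enorm_ge0 x))//.
by move=> [i j] _ /=; rewrite (ord1 j) normr_coord_le_enorm.
Qed.

(** Each of the [n] squares is at most [|x|^2]; then [n <= n^2] gives the crude constant [n] instead
    of its square root. *)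
Lemma enorm_le_normr n (x : 'cV[R]_n) : enorm x <= n%:R * `|x|.
Proof.
rewrite -(ler_pXn2r (_ : 0 < 2)%N) ?nnegrE ?mulr_ge0 ?enorm_ge0//.
have xi i : x i 0 * x i 0 <= `|x| ^+ 2.
  rewrite -expr2 -real_normK ?num_real// ler_pXn2r ?nnegrE//.
  rewrite [leRHS]/Num.Def.normr/= mx_normrE.
  exact: (le_bigmax _ (fun ij => `|x ij.1 ij.2|) (i, 0)).
rewrite sqr_enorm (le_trans (ler_sum _ (fun i _ => xi i)))//.
rewrite sumr_const card_ord exprMn -[leLHS]mulr_natl ler_wpM2r ?sqr_ge0//.
by rewrite -natrX ler_nat; case: n {x xi} => // n; rewrite -mulnn leq_pmulr.
Qed.

Lemma enorm_lipschitz_continuous n (f : 'cV[R]_n -> R) (k : R) :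
  (forall x y, `|f x - f y| <= k * enorm (x - y)) -> continuous f.
Proof.
move=> fk x; apply/(@cvgrPdist_lt _ _ _ _ (nbhs_filter x)) => e e0.
(* The factor [n] pays for passing to the max norm, which defines the neighbourhoods; the [+ 1]
   keeps the denominator positive. *)
have K0 : 0 < `|k| * n%:R + 1 by rewrite ltr_wpDl// mulr_ge0.
apply/nbhs_ballP; exists (e / (`|k| * n%:R + 1)); rewrite /= ?divr_gt0// => y.
rewrite mx_norm_ball /ball_ /= => xy; rewrite (le_lt_trans (fk _ _))//.
move: xy; rewrite ltr_pdivlMr//; apply: le_lt_trans.
have := enorm_le_normr (x - y); have := enorm_ge0 (x - y).
have := ler_norm k; have := normr_ge0 k; have := normr_ge0 (x - y).
set d := enorm _; set N := `|x - y| => N0 k0 kk d0 dN.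
rewrite (@le_trans _ _ (`|k| * d))// ?ler_wpM2r//.
by rewrite (le_trans (ler_wpM2l k0 dN))//; nra.
Qed.

(** Serves to carry the Heine-Borel theorem from row vectors to column vectors. *)
Lemma trmx_continuous m n : continuous (@trmx R m n).
Proof.
move=> M A [P MP PA]; exists (fun i j => P j i) => [i j|N PN].
  by have := MP j i; rewrite mxE.
by apply: PA => i j /=; rewrite mxE.
Qed.

Lemma enorm_bounded_closed_compact n (A : set 'cV[R]_n) (x0 : 'cV[R]_n)
    (r : R) :
  (forall x, A x -> enorm (x - x0) <= r) -> closed A -> compact A.
Proof.
move=> Ar clA.
have -> : A = trmx @` (trmx @^-1` A : set 'rV_n).
  apply/seteqP; split => [x Ax|_ [x Ax <-]//].
  by exists x^T; rewrite /= ?trmxK.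
apply: continuous_compact; first exact/continuous_subspaceT/trmx_continuous.
apply: bounded_closed_compact; last first.
  by apply: preimage_closed => // x _; exact: trmx_continuous.
exists (r + enorm x0); split; first exact: num_real.
move=> M rM x Ax /=.
have -> : `|x| = `|x^T|.
  rewrite /Num.Def.normr/= !mx_normrE; apply/eqP; rewrite eq_le.
  apply/andP; split; apply: bigmax_le; rewrite ?bigmax_ge_id// => -[i j] _ /=.
    apply: le_trans (le_bigmax _ _ (j, i)) => /=; by rewrite mxE.
  apply: le_trans (le_bigmax _ _ (j, i)) => /=; by rewrite mxE.
rewrite (le_trans (normr_le_enorm _))// (le_trans _ (ltW rM))//.
by rewrite -{1}(subrK x0 x^T) (le_trans (ler_enormD _ _))// lerD2r Ar.
Qed.

End Euclidean.

(** * The second-order cone and its absolute value *)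

Section SecondOrderCone.
Context {R : realType} {m : nat}.
Implicit Types x y : 'cV[R]_m.+1.

Lemma dot_soc x y :
  dot x y = soc_head x * soc_head y + dot (soc_tail x) (soc_tail y).
Proof.
rewrite /dot big_ord_recl; congr (_ + _); apply: eq_bigr => i _.
by rewrite !mxE !rshift1.
Qed.

Lemma soc_headD x y : soc_head (x + y) = soc_head x + soc_head y.
Proof. by rewrite /soc_head mxE. Qed.

Lemma soc_headN x : soc_head (- x) = - soc_head x.
Proof. by rewrite /soc_head mxE. Qed.

Lemma soc_headZ a x : soc_head (a *: x) = a * soc_head x.
Proof. by rewrite /soc_head mxE. Qed.

Lemma soc_tailD x y : soc_tail (x + y) = soc_tail x + soc_tail y.
Proof. by apply/colP => i; rewrite !mxE. Qed.

Lemma soc_tailN x : soc_tail (- x) = - soc_tail x.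
Proof. by apply/colP => i; rewrite !mxE. Qed.

Lemma soc_tailZ a x : soc_tail (a *: x) = a *: soc_tail x.
Proof. by apply/colP => i; rewrite !mxE. Qed.

Lemma soc_head_vec (a : R) (v : 'cV[R]_m) : soc_head (soc_vec a v) = a.
Proof.
(* The index [0] of the whole vector and the shifted index [0] of the upper block are identified
   through their values. *)
have := col_mxEu (const_mx a : 'cV[R]_1) v 0 0.
rewrite [RHS]mxE => h; rewrite -[RHS]h; congr (col_mx _ _ _ _); exact: val_inj.
Qed.

Lemma soc_tail_vec (a : R) (v : 'cV[R]_m) : soc_tail (soc_vec a v) = v.
Proof. exact: col_mxKd. Qed.

(* With [r^-1 = 0] at [r = 0], the generic formulas also cover [x2 = 0]. *)
Lemma soc_head_abs x (r := enorm (soc_tail x)) :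
  soc_head (soc_abs x) = (`|soc_head x - r| + `|soc_head x + r|) / 2.
Proof.
rewrite /soc_abs; case: eqP => [x0|_].
  by rewrite soc_head_vec /r x0 enorm0 subr0 addr0 mulrDl -splitr.
by rewrite soc_headZ soc_head_vec mulrC.
Qed.

Lemma soc_tail_abs x (r := enorm (soc_tail x)) :
  soc_tail (soc_abs x) =
  ((`|soc_head x + r| - `|soc_head x - r|) / 2 / r) *: soc_tail x.
Proof.
rewrite /soc_abs; case: eqP => [->|_]; first by rewrite soc_tail_vec scaler0.
by rewrite soc_tailZ soc_tail_vec !scalerA (mulrC 2^-1).
Qed.

Definition in_soc x : Prop := enorm (soc_tail x) <= soc_head x.

(** By Cauchy-Schwarz, [<x2, y2> >= - ||x2|| ||y2|| >= - x1 y1]. *)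
Lemma dot_soc_ge0 x y : in_soc x -> in_soc y -> 0 <= dot x y.
Proof.
rewrite /in_soc dot_soc => hx hy.
have := normr_dot_le (soc_tail x) (soc_tail y); rewrite ler_norml => /andP[].
have := enorm_ge0 (soc_tail x); have := enorm_ge0 (soc_tail y).
nra.
Qed.

(** The squared norm is half the sum of the squared spectral values, which absolute values preserve:
    [((p + q) / 2)^2 + ((q - p) / 2)^2 = (p^2 + q^2) / 2 = a^2 + r^2]. *)
Lemma enorm_soc_abs x : enorm (soc_abs x) = enorm x.
Proof.
rewrite !enorm_dot !dot_soc soc_head_abs soc_tail_abs !dotE -!sqr_enorm.
congr Num.sqrt; set r := enorm _; set a := soc_head x.
set p := `|a - r|; set q := `|a + r|.
have pE : p ^+ 2 = (a - r) ^+ 2 by rewrite real_normK ?num_real.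
have qE : q ^+ 2 = (a + r) ^+ 2 by rewrite real_normK ?num_real.
have [r0|r0] := eqVneq r 0.
  by move: pE qE; rewrite /p /q r0 subr0 addr0; lra.
have -> : (q - p) / 2 / r * ((q - p) / 2 / r * r ^+ 2) = (q - p) ^+ 2 / 4.
  by field.
lra.
Qed.

(** The spectral values of [|x| + x] are [|a - r| + (a - r)] and [|a + r| + (a + r)], both
    nonnegative. *)
Lemma in_soc_absD x : in_soc (soc_abs x + x).
Proof.
rewrite /in_soc soc_headD soc_tailD soc_head_abs soc_tail_abs.
have := enorm_ge0 (soc_tail x); set r := enorm _; set a := soc_head x => rge0.
set p := `|a - r|; set q := `|a + r|.
have -> k : k *: soc_tail x + soc_tail x = (k + 1) *: soc_tail x.
  by rewrite scalerDl scale1r.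
rewrite enormZ -/r -{2}(ger0_norm rge0) -normrM mulrDl mul1r.
have [r0|r0] := eqVneq r 0.
  rewrite r0 mulr0 add0r normr0 /p /q r0 subr0 addr0.
  by have := ler_norm (- a); rewrite normrN; lra.
rewrite divfK//.
have := ler_norm (- (a - r)); have := ler_norm (- (a + r)).
have := ler_norm (a - r); have := ler_norm (a + r).
rewrite !normrN -/p -/q ler_norml; lra.
Qed.

(** Negating [x] negates and exchanges the values [a - r] and [a + r] and reverses the tail, so
    [|- x| = |x|] and the previous lemma applies to [- x]. *)
Lemma in_soc_absB x : in_soc (soc_abs x - x).
Proof.
have -> : soc_abs x = soc_abs (- x); last exact: in_soc_absD.
rewrite /soc_abs soc_tailN soc_headN oppr_eq0 normrN enormN.
case: ifP => // _; set r := enorm _; set a := soc_head x.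
have -> : - a - r = - (a + r) by ring.
have -> : - a + r = - (a - r) by ring.
by rewrite !normrN addrC !scalerN -scaleNr opprB.
Qed.

(* The cone is self-dual and [|x| + x], [|x| - x] lie in it, so
   [<x, y> <= <|x|, |y|>]; the norms of [x] and [|x|] agree. *)
Lemma soc_abs_lipschitz x y : enorm (soc_abs x - soc_abs y) <= enorm (x - y).
Proof.
rewrite -(ler_pXn2r (_ : 0 < 2)%N) ?nnegrE ?enorm_ge0// !sqr_enorm !dotE.
rewrite -!sqr_enorm !enorm_soc_abs !sqr_enorm (dotC y) (dotC (soc_abs y)).
have := dot_soc_ge0 (in_soc_absD x) (in_soc_absB y).
have := dot_soc_ge0 (in_soc_absB x) (in_soc_absD y).
rewrite !dotE; lra.
Qed.

End SecondOrderCone.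

(** * The spectral norm as an operator bound *)

Section SpectralNorm.
Context {R : realType}.

(** Makes the supremum in [spectral_norm] a genuine least upper bound. Since [|u j| <= 1], every
    entry of [A u] is at most the sum of all [|A i j|]; the factor [m] passes from the max norm to
    the Euclidean one. *)
Lemma spectral_norm_has_sup m n (A : 'M[R]_(m, n)) :
  has_sup [set enorm (A *m u) | u in [set u : 'cV[R]_n | enorm u <= 1]].
Proof.
split; first by exists (enorm (A *m 0)); exists 0; rewrite //= enorm0.
exists (\sum_i \sum_j `|A i j| * m%:R) => _ [u /= u1 <-].
rewrite (le_trans (enorm_le_normr _))//.
under eq_bigr do rewrite -mulr_suml.
rewrite -mulr_suml mulrC ler_wpM2r//.
rewrite [leLHS]/Num.Def.normr/= mx_normrE bigmax_le//.
  by apply: sumr_ge0 => i _; apply: sumr_ge0.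
move=> [i k] _ /=; rewrite (ord1 k) mxE (bigD1 i)//=.
rewrite ler_wpDr ?sumr_ge0// => [j _|]; first exact: sumr_ge0.
rewrite (le_trans (ler_norm_sum _ _ _))// ler_sum// => j _.
rewrite normrM ler_piMr// (le_trans (normr_coord_le_enorm _ _))//.
Qed.

Lemma enorm_mulmx_le m n (A : 'M[R]_(m, n)) (u : 'cV[R]_n) :
  enorm (A *m u) <= spectral_norm A * enorm u.
Proof.
have [->|u0] := eqVneq u 0; first by rewrite mulmx0 !enorm0 mulr0.
have u_gt0 : 0 < enorm u by rewrite lt_neqAle enorm_ge0 eq_sym enorm_eq0 u0.
rewrite -ler_pdivrMr// mulrC -[(enorm u)^-1]ger0_norm ?invr_ge0 ?enorm_ge0//.
rewrite -enormZ scalemxAr; apply: ub_le_sup.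
  by have [] := spectral_norm_has_sup A.
exists ((enorm u)^-1 *: u) => //=.
by rewrite enormZ ger0_norm ?invr_ge0 ?enorm_ge0// mulVf// gt_eqF.
Qed.

End SpectralNorm.

(** * Fixed points of Euclidean contractions *)

(** At a minimizer [c] of [f] on the invariant ball [B], [f c <= f (T c) <= q * f c] with [q < 1]
    forces [f c = 0]. *)
Lemma enorm_contraction_fixpoint (R : realType) (n : nat)
    (T : 'cV[R]_n -> 'cV[R]_n) (q : R) : 0 <= q -> q < 1 ->
  (forall x y, enorm (T x - T y) <= q * enorm (x - y)) -> exists x, T x = x.
Proof.
move=> q0 q1 Tq.
pose f x := enorm (x - T x).
(* This radius solves [||T 0|| + q r = r], which makes [B] invariant under [T]. *)
pose r := enorm (T 0) / (1 - q).
have r0 : 0 <= r by rewrite divr_ge0 ?enorm_ge0// subr_ge0 ltW.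
pose B : set 'cV[R]_n := [set x | enorm x <= r].
have TB x : B x -> B (T x).
  rewrite /B/= => xr; rewrite -(subrK (T 0) (T x)).
  rewrite (le_trans (ler_enormD _ _))//.
  have := Tq x 0; rewrite subr0.
  have : enorm (T 0) = r * (1 - q) by rewrite divfK// gt_eqF// subr_gt0.
  nra.
have cB : compact B.
  apply: (@enorm_bounded_closed_compact _ _ _ 0 r) => [x|].
    by rewrite subr0.
  rewrite (_ : B = (@enorm R n) @^-1` [set a | a <= r])//.
  apply: preimage_closed; last exact: closed_le.
  move=> x _; apply: (@enorm_lipschitz_continuous _ _ _ 1) => y z.
  by rewrite mul1r ler_dist_enorm.
have cf : {within B, continuous f}.
  apply/continuous_subspaceT/(@enorm_lipschitz_continuous _ _ _ (1 + q)) => x y.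
  rewrite (le_trans (ler_dist_enorm _ _))// opprD opprK addrACA.
  rewrite [- T x + _]addrC (le_trans (ler_enormD _ _))//.
  by rewrite mulrDl mul1r lerD2l enorm_distC.
have [|c] := compact_EVT_min _ cB cf; first by exists 0; rewrite /B/= enorm0.
rewrite inE => Bc /(_ (T c)); rewrite inE => /(_ (TB _ Bc)) fc.
have := Tq c (T c); rewrite -/(f c) -/(f (T c)) => fTc.
exists c; apply/esym/eqP; rewrite -subr_eq0 -enorm_eq0 -/(f c).
have := enorm_ge0 (c - T c); rewrite -/(f c) => f0.
by rewrite eq_le f0 andbT; nra.
Qed.

Lemma enorm_distance_continuous (R : realType) (n : nat) (xs : 'cV[R]_n) :
  continuous (fun y : 'cV[R]_n => enorm (y - xs)).
Proof.
apply: (@enorm_lipschitz_continuous _ _ _ 1) => a b.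
rewrite mul1r (le_trans (ler_dist_enorm _ _))// opprB addrA subrK.
exact: lexx.
Qed.

(** * Lyapunov's direct method for the squared distance to [xs] *)

Section Lyapunov.
Context {R : realType} {n : nat}.
Variables (g : 'cV[R]_n -> 'cV[R]_n) (xs : 'cV[R]_n) (W : 'cV[R]_n -> R).
Hypothesis W_ge0 : forall x, 0 <= W x.
Hypothesis W_eq0 : forall x, W x = 0 -> x = xs.
Hypothesis W_cont : continuous W.
(** Along a solution the derivative of [||x - xs||^2] is [2 <x - xs, g x>], hence at most
    [- 2 W x]. *)
Hypothesis W_dissip : forall x, dot (x - xs) (g x) <= - W x.

(** The corrected function [V] has derivative [2 (<x - xs, g x> + mu) <= 0]. Taking [mu = 0] shows
    that the distance is nonincreasing; [mu > 0] gives a linear rate of decay. *)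
Lemma solution_decay (t0 : R) (x0 : 'cV[R]_n) (x : R -> 'cV[R]_n) (mu : R) :
  is_solution g t0 x0 x -> (forall t, t0 < t -> mu <= W (x t)) ->
  forall s t, t0 <= s -> s <= t ->
  enorm (x t - xs) ^+ 2 + 2 * mu * (t - s) <= enorm (x s - xs) ^+ 2.
Proof.
move=> [_ xc xd] muW s t ts st.
pose V u := enorm (x u - xs) ^+ 2 + 2 * mu * u.
suff : V t <= V s by rewrite /V; lra.
(* As a sum of coordinate squares plus a linear term, [V] can be differentiated termwise. *)
have VE : V = \sum_(i < n) (fun u => (x u i 0 - xs i 0) ^+ 2) + *%R (2 * mu).
  apply/funext => u; rewrite /V sqr_enorm fctE fct_sumE; congr (_ + _).
  by apply: eq_bigr => i _; rewrite !mxE expr2.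
have Vd u : t0 < u ->
    is_derive u 1 V (2 * (dot (x u - xs) (g (x u)) + mu)).
  move=> tu; have [dx xE] := xd u tu.
  have xid i : is_derive u 1 (fun u => x u i 0) (g (x u) i 0).
    have /derivable_mxP/(_ i 0) dxi := dx.
    by apply: DeriveDef => //; rewrite -xE derive_mx// mxE.
  rewrite VE; apply: is_derive_eq.
  rewrite mulrDr mulr_sumr; congr (_ + _); last by rewrite /GRing.scale/= mulr1.
  apply: eq_bigr => i _; rewrite !mxE subr0 /GRing.scale/=; ring.
apply: (@ler0_derive1_nincry _ V t0) => //.
- by move=> u; rewrite in_itv/= andbT => tu; have [] := Vd u tu.
- move=> u; rewrite in_itv/= andbT => tu.
  rewrite derive1E; have [_ ->] := Vd u tu.
  by have := W_dissip (x u); have := muW u tu; lra.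
(* The equation is given only after [t0]; continuity at [t0] extends the monotonicity to the closed
   half-line. *)
- have nc : continuous (fun y : 'cV[R]_n => enorm (y - xs) ^+ 2).
    move=> y; apply: (@continuous_comp 'cV[R]_n R R
      (fun y => enorm (y - xs)) (fun r : R => r ^+ 2)).
      exact: enorm_distance_continuous.
    exact: exprn_continuous.
  move=> u; apply: cvgD.
    exact: (@continuous_comp (subspace `[t0, +oo[) 'cV[R]_n R x _ u (xc u)
      (nc _)).
  by apply: continuous_subspaceT => ?; apply: cvgMr.
Qed.

(** The distance to [xs] is nonincreasing, so [delta = eps] works. *)
Lemma lyapunov_stable : stable g xs.
Proof.
move=> eps eps0; exists eps => // t0 x0 x xsol x0xs t t0t.
have := solution_decay xsol (fun t _ => W_ge0 (x t)) (lexx t0) t0t.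
rewrite mulr0 mul0r addr0 ler_pXn2r ?nnegrE ?enorm_ge0// => /le_lt_trans; apply.
by case: xsol => ->.
Qed.

Lemma lyapunov_attractive (t0 : R) (x0 : 'cV[R]_n) (x : R -> 'cV[R]_n) :
  is_solution g t0 x0 x -> x t @[t --> +oo] --> xs.
Proof.
move=> xsol.
have decr s t : t0 <= s -> s <= t -> enorm (x t - xs) <= enorm (x s - xs).
  move=> ts st; have := solution_decay xsol (fun t _ => W_ge0 (x t)) ts st.
  by rewrite mulr0 mul0r addr0 ler_pXn2r ?nnegrE ?enorm_ge0.
(* By monotonicity, a trajectory that enters a ball around [xs] once stays in it. *)
suff ev e : 0 < e -> exists2 T, t0 <= T & enorm (x T - xs) < e.
  apply/cvgrPdist_lt => e e0; have [T t0T xT] := ev e e0.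
  exists T; split; first exact: num_real.
  move=> t /ltW Tt; rewrite distrC (le_lt_trans (normr_le_enorm _))//.
  exact: le_lt_trans (decr _ _ t0T Tt) xT.
move=> e0; apply: contrapT => noT.
have far t : t0 <= t -> e <= enorm (x t - xs).
  by move=> t0t; rewrite leNgt; apply/negP => xt; apply: noT; exists t.
pose r := enorm (x t0 - xs).
(* This closed annulus traps the trajectory and avoids [xs], so [W] has a positive minimum on it. *)
pose K : set 'cV[R]_n := (fun y => enorm (y - xs)) @^-1` `[e, r].
have Kx t : t0 <= t -> K (x t).
  by move=> t0t; rewrite /K/= in_itv/= far// decr.
have cK : compact K.
  apply: (@enorm_bounded_closed_compact _ _ _ xs r) => [y|].
    by rewrite /K/= in_itv/= => /andP[].
  apply: preimage_closed; last exact: itv_closed.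
  by move=> y _; exact: enorm_distance_continuous.
have [|c] := compact_EVT_min _ cK (continuous_subspaceT W_cont).
  by exists (x t0); exact: Kx.
rewrite inE => Kc Wc.
have Wc0 : 0 < W c.
  rewrite lt_neqAle W_ge0 andbT eq_sym; apply/eqP => /W_eq0 cxs.
  by move: Kc; rewrite /K/= cxs subrr enorm0 in_itv/= leNgt e0.
have W_lb t : t0 < t -> W c <= W (x t).
  by move=> /ltW t0t; apply: Wc; rewrite inE; exact: Kx.
(* After this delay the decay at rate [2 * W c] would amount to [r^2 + 1], more than the initial
   value [r^2]. *)
have d0 : 0 <= (r ^+ 2 + 1) / (2 * W c).
  by rewrite divr_ge0 ?addr_ge0 ?sqr_ge0 ?mulr_ge0 ?W_ge0.
have := @solution_decay _ _ _ _ xsol W_lb t0 (t0 + (r ^+ 2 + 1) / (2 * W c)).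
rewrite lerDl => /(_ (lexx _) d0).
rewrite addrAC subrr add0r (mulrC (2 * W c)) divfK; last first.
  by rewrite mulf_neq0 ?gt_eqF.
rewrite -/r; set z := enorm _ => h; have := sqr_ge0 z; lra.
Qed.

End Lyapunov.

(** * Application to the absolute value equation [A x - |x| = b] *)

Section AbsoluteValueEquation.
Context {R : realType} {m : nat}.
Variables (A : 'M[R]_m.+1) (b : 'cV[R]_m.+1) (gamma : R).
Hypotheses (A_unit : A \in unitmx) (gamma_gt0 : 0 < gamma).

Let residual (x : 'cV[R]_m.+1) := b + soc_abs x - A *m x.

(** Multiplication by [gamma A^T] is injective, as [gamma] is nonzero and [A^T] is invertible. *)
Lemma equilibrium_residual x :
  equilibrium (soc_ave_field gamma A b) x <-> residual x = 0.
Proof.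
rewrite /equilibrium /soc_ave_field -/(residual x).
split=> [/eqP|->]; last by rewrite mulmx0 scaler0.
rewrite scaler_eq0 gt_eqF//= => /eqP /(congr1 (mulmx (invmx A^T))).
by rewrite mulKmx ?unitmx_tr// mulmx0.
Qed.

Lemma enorm_invmx_le x :
  spectral_norm (invmx A) <= 1 -> enorm x <= enorm (A *m x).
Proof.
move=> A1; rewrite -{1}(mulKmx A_unit x) (le_trans (enorm_mulmx_le _ _))//.
by rewrite ler_piMl// enorm_ge0.
Qed.

Lemma residual_dissip x xs :
  spectral_norm (invmx A) <= 1 -> residual xs = 0 ->
  dot (x - xs) (soc_ave_field gamma A b x) <=
    - (gamma / 2 * enorm (residual x) ^+ 2).
Proof.
move=> A1 fxs.
pose u := x - xs; pose w := soc_abs x - soc_abs xs.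
have fx : residual x = w - A *m u.
  rewrite -[LHS]subr0 -fxs /residual /w /u mulmxBr.
  by apply/colP => i; rewrite !mxE; ring.
have : enorm w <= enorm (A *m u).
  exact: le_trans (soc_abs_lipschitz _ _) (enorm_invmx_le _ A1).
rewrite /soc_ave_field -/(residual x) dotZr dot_trmxr -/u fx.
rewrite -(ler_pXn2r (_ : 0 < 2)%N) ?nnegrE ?enorm_ge0// !sqr_enorm.
move: (A *m u) w {fx} => v w wv.
rewrite !dotE (dotC w v).
(* The claim reduces to [<v, w - v> + ||w - v||^2 / 2 = (||w||^2 - ||v||^2) / 2 <= 0], scaled by
   [gamma]. *)
have := mulr_ge0 (ltW gamma_gt0) (_ : 0 <= dot v v - dot w w).
rewrite subr_ge0 => /(_ wv) => ?; lra.
Qed.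

Lemma residual_norm_continuous :
  continuous (fun x => gamma / 2 * enorm (residual x) ^+ 2).
Proof.
have fc : continuous (fun x => enorm (residual x)).
  (* The [1] comes from the nonexpansive [soc_abs], the other term from [A]. *)
  apply: (@enorm_lipschitz_continuous _ _ _ (1 + spectral_norm A)) => x y.
  rewrite (le_trans (ler_dist_enorm _ _))//.
  have -> : residual x - residual y =
            (soc_abs x - soc_abs y) + - (A *m (x - y)).
    by rewrite /residual mulmxBr; apply/colP => i; rewrite !mxE; ring.
  rewrite (le_trans (ler_enormD _ _))// enormN mulrDl mul1r lerD//.
    exact: soc_abs_lipschitz.
  exact: enorm_mulmx_le.
move=> x; apply: (@continuous_comp 'cV[R]_m.+1 R R
  (fun y => enorm (residual y)) (fun r => gamma / 2 * r ^+ 2)); first exact: fc.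
by apply: cvgMr; exact: exprn_continuous.
Qed.

(** The rate [W] vanishes only where the residual does, that is, at equilibria; uniqueness then
    gives [W x = 0 -> x = xs]. *)
Lemma unique_equilibrium_globally_asymptotically_stable xs :
  spectral_norm (invmx A) <= 1 ->
  unique (equilibrium (soc_ave_field gamma A b)) xs ->
  globally_asymptotically_stable (soc_ave_field gamma A b) xs.
Proof.
move=> A1 [/equilibrium_residual fxs uxs].
pose W x := gamma / 2 * enorm (residual x) ^+ 2.
have W_ge0 x : 0 <= W x by rewrite mulr_ge0 ?sqr_ge0 ?divr_ge0 ?ltW.
have W_dissip x := residual_dissip x A1 fxs.
split; first exact: lyapunov_stable W_ge0 W_dissip.
move=> t0 x0 x; apply: (lyapunov_attractive W_ge0 _ _ W_dissip) => [y /eqP|].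
  rewrite mulf_eq0 gt_eqF ?divr_gt0//= sqrf_eq0 enorm_eq0 => /eqP fy.
  by apply/esym/uxs/equilibrium_residual.
exact: residual_norm_continuous.
Qed.

Lemma exists_unique_equilibrium :
  spectral_norm (invmx A) < 1 ->
  exists xs, unique (equilibrium (soc_ave_field gamma A b)) xs.
Proof.
move=> A1.
pose T x := invmx A *m (b + soc_abs x).
have TE x : residual x = 0 <-> T x = x.
  rewrite /residual /T; split => [/subr0_eq ->|{2}<-]; first by rewrite mulKmx.
  by rewrite mulKVmx ?subrr.
(* The all-ones vector is nonzero in dimension [m.+1], so the bound on its image forces the norm to
   be nonnegative. *)
have q0 : 0 <= spectral_norm (invmx A).
  have := enorm_mulmx_le (invmx A) (const_mx 1 : 'cV[R]_m.+1).
  have e0 : 0 < enorm (const_mx 1 : 'cV[R]_m.+1).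
    rewrite lt_neqAle enorm_ge0 andbT eq_sym enorm_eq0.
    by apply/eqP => /colP/(_ 0); rewrite !mxE; apply/eqP; rewrite oner_neq0.
  by move/(le_trans (enorm_ge0 _)); rewrite pmulr_lge0.
have Tq x y : enorm (T x - T y) <= spectral_norm (invmx A) * enorm (x - y).
  rewrite /T -mulmxBr opprD addrACA subrr add0r.
  rewrite (le_trans (enorm_mulmx_le _ _))// ler_wpM2l//.
  exact: soc_abs_lipschitz.
have [xs Txs] := enorm_contraction_fixpoint q0 A1 Tq.
exists xs; split; first exact/equilibrium_residual/TE.
move=> y /equilibrium_residual/TE Ty; apply/eqP; rewrite -subr_eq0 -enorm_eq0.
(* Two fixed points at distance [d] satisfy [d <= q d] with [q < 1], hence [d = 0]. *)
have := Tq xs y; rewrite Txs Ty; have := enorm_ge0 (xs - y).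
by set d := enorm _ => d0 h; rewrite eq_le d0 andbT; nra.
Qed.

End AbsoluteValueEquation.

Theorem theorem3p5 (R : realType) (m : nat) (A : 'M[R]_m.+1)
    (b : 'cV[R]_m.+1) (gamma : R) (hA : A \in unitmx) (hgamma : 0 < gamma) :
  (spectral_norm (invmx A) <= 1 ->
     forall xs : 'cV[R]_m.+1, unique (equilibrium (soc_ave_field gamma A b)) xs ->
       asymptotically_stable (soc_ave_field gamma A b) xs) /\
  (spectral_norm (invmx A) < 1 ->
     exists2 xs : 'cV[R]_m.+1, unique (equilibrium (soc_ave_field gamma A b)) xs &
       globally_asymptotically_stable (soc_ave_field gamma A b) xs).
Proof.
split=> [A1 xs uxs|A1].
  have [xs_stable xs_attr] :=
    unique_equilibrium_globally_asymptotically_stable hA hgamma A1 uxs.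
  (* Attraction is global, so the radius [1] is an arbitrary choice. *)
  by split=> //; exists 1 => // t0 x0 x xsol _; exact: xs_attr xsol.
have [xs uxs] := exists_unique_equilibrium b hA hgamma A1.
exists xs => //.
exact: unique_equilibrium_globally_asymptotically_stable (ltW A1) uxs.
Qed.
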